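(* Let $M$ be an oriented smooth $2$-dimensional manifold and let $A,A'\in\mathbf{Diff}_3(\mathbf 1)$ be scalar linear differential operators of the third order on $M$ in general position. Let $\{U_\alpha,\ \phi_\alpha=(I_1^\alpha(A),I_2^\alpha(A)):U_\alpha\to\mathbf D_\alpha\subset\mathbb R^2\}$ be a natural atlas for $A$ with natural model $\mathcal D(A)=(\mathbf D_\alpha,\mathbf D_{\alpha\beta},\phi_{\alpha\beta},A_\alpha,A_{\alpha\beta})$. Then $A$ and $A'$ are equivalent with respect to the group of diffeomorphisms $\mathcal G(M)$ if and only if the following conditions hold: the open sets $$U'_\alpha=(\phi'_\alpha)^{-1}(\mathbf D_\alpha),\qquad \phi'_\alpha=(I_1^\alpha(A'),I_2^\alpha(A')):M\to\mathbb R^2,$$ constitute a natural atlas for the operator $A'$; the transition maps coincide, $\phi'_{\alpha\beta}=\phi_{\alpha\beta}:\mathbf D_{\alpha\beta}\to\mathbf D_{\beta\alpha}$; and $$A_\alpha=\phi'_{\alpha*}\big(A'|_{U'_\alpha}\big),\qquad A_{\alpha\beta}=\phi'_{\alpha*}\big(A'|_{U'_\alpha\cap U'_\beta}\big).$$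
   Context: $\mathbf{Diff}_3(\mathbf 1)$ denotes scalar linear differential operators of order $\le3$ on $C^\infty(M)$. $\mathcal G(M)$ acts by $\phi_*:A\mapsto\phi_*\circ A\circ\phi_*^{-1}$, $\phi_*f=f\circ\phi^{-1}$; $A$ and $A'$ are equivalent if $\psi_*(A)=A'$ for some $\psi\in\mathcal G(M)$. A natural (differential) invariant of order $k$ is a function $I$ on the space $\mathbf J^k(\pi)$ of $k$-jets of sections of the bundle $\pi$ of third order scalar operators which is $\mathcal G(M)$-invariant and rational along the fibres of $\mathbf J^k(\pi)\to M$. Its value on $A$ is the function $I(A)=j_k(A)^*(I)$ on $M$. $A$ is in general position if for any point $a\in M$ there are two natural invariants $I_1,I_2$ with $dI_1(A)\wedge dI_2(A)\ne0$ in a neighborhood $U$ of $a$; then $I_1(A),I_2(A)$ are called natural coordinates in $U$. An atlas $\{U_\alpha,\phi_\alpha:U_\alpha\to\mathbf D_\alpha\subset\mathbb R^2\}$ is natural (for $A$) if the coordinates $\phi_\alpha=(I_1^\alpha(A),I_2^\alpha(A))$ are given by natural invariants, with distinct pairs for distinct indices: $(I_1^\alpha(A),I_2^\alpha(A))\neq(I_1^\beta(A),I_2^\beta(A))$ when $\alpha\ne\beta$. Put $\mathbf D_{\alpha\beta}=\phi_\alpha(U_\alpha\cap U_\beta)$; the domains $\mathbf D_\alpha$ and $\mathbf D_{\alpha\beta}$ are assumed connected and simply connected. Let $\phi_{\alpha\beta}:\mathbf D_{\alpha\beta}\to\mathbf D_{\beta\alpha}$ be the transition maps, $A_\alpha=\phi_{\alpha*}(A|_{U_\alpha})$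 and $A_{\alpha\beta}=\phi_{\alpha*}(A|_{U_\alpha\cap U_\beta})$. The collection $(\mathbf D_\alpha,\mathbf D_{\alpha\beta},\phi_{\alpha\beta},A_\alpha,A_{\alpha\beta})$ is the natural model of $A$. $\phi'_{\alpha\beta}$ denotes the transition maps of the atlas $\{U'_\alpha,\phi'_\alpha\}$.
   Formalization: With U'_α the full preimage, ''only if'' can fail (φ_α may repeat values off U_α). Proved instead: the stated equivalence when each U_α=φ_α^{-1}(D_α) in M; and, for any natural atlas, the equivalence with U'_α some open subset of the preimage mapped diffeomorphically onto D_α. *)

(* Defs.v *)
From HB Require Import structures.
From mathcomp Require Import all_boot all_order all_algebra.
From mathcomp Require Import all_classical all_reals all_analysis.
From mathcomp Require mpoly.
Set Implicit Arguments.
Unset Strict Implicit.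
Unset Printing Implicit Defensive.
Import Order.TTheory GRing.Theory Num.Theory.
Import numFieldNormedType.Exports.
Local Open Scope classical_set_scope.
Local Open Scope ring_scope.

Section Plane.
Context {R : realType}.
Notation V := (R * R)%type.

Definition axis (i : bool) : V := if i then (0, 1) else (1, 0).

(* [pd w f] is the iterated partial derivative of [f] along the word [w]:
   [false] stands for the first coordinate, [true] for the second one. *)
Definition pd (w : seq bool) (f : V -> R) : V -> R :=
  foldr (fun i g => 'D_(axis i) g) f w.

(* C^oo on the open set D; f is unconstrained outside D. *)
Definition smooth_on (D : set V) (f : V -> R) : Prop :=
  forall w x, D x -> differentiable (pd w f) x.

Definition smooth_map_on (D : set V) (g : V -> V) : Prop :=
  smooth_on D (fun y => (g y).1) /\ smooth_on D (fun y => (g y).2).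

Definition jacobian (g : V -> V) (y : V) : R :=
  'D_(axis false) (fun z => (g z).1) y * 'D_(axis true) (fun z => (g z).2) y -
  'D_(axis true) (fun z => (g z).1) y * 'D_(axis false) (fun z => (g z).2) y.

(* Multi-indices (i, j) with i + j <= n. *)
Definition midx (n : nat) : finType :=
  {p : 'I_n.+1 * 'I_n.+1 | (p.1 + p.2 <= n)%N}.

Definition word_of n (s : midx n) : seq bool :=
  nseq (val s).1 false ++ nseq (val s).2 true.

(* The empty set is allowed (overlaps of charts may be empty). *)
Definition simply_connected (D : set V) : Prop :=
  forall g : R -> V,
    {within `[0, 1]%classic, continuous g} -> g 0 = g 1 ->
    (forall t, t \in `[0, 1] -> D (g t)) ->
    exists H : R * R -> V,
      [/\ {within `[0, 1]%classic `*` `[0, 1]%classic, continuous H},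
          forall p, (`[0, 1]%classic `*` `[0, 1]%classic) p -> D (H p),
          forall t, t \in `[0, 1] -> H (0, t) = g t,
          forall t, t \in `[0, 1] -> H (1, t) = g 0 &
          forall s, s \in `[0, 1] -> H (s, 0) = g 0 /\ H (s, 1) = g 0].

End Plane.

(* A homeomorphism [cmap] of the open set [cdom] onto the open set [cimg] of
   R^2, with inverse [cinv]; both maps are arbitrary elsewhere. *)
Record chart (R : realType) (T : topologicalType) := Chart {
  cdom : set T;
  cimg : set (R * R);
  cmap : T -> R * R;
  cinv : R * R -> T;
  cdom_open : open cdom;
  cimg_open : open cimg;
  cmap_img : forall x, cdom x -> cimg (cmap x);
  cinv_dom : forall y, cimg y -> cdom (cinv y);
  cmapK : forall x, cdom x -> cinv (cmap x) = x;
  cinvK : forall y, cimg y -> cmap (cinv y) = y;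
  cmap_cont : forall x, cdom x -> {for x, continuous cmap};
  cinv_cont : forall y, cimg y -> {for y, continuous cinv} }.

Section Transition.
Context {R : realType} {T : topologicalType}.
Implicit Types c d : chart R T.

Definition overlap c d : set (R * R) := cmap c @` (cdom c `&` cdom d).

Definition transition c d : R * R -> R * R := fun y => cmap d (cinv c y).

End Transition.

(* The orientation is carried by the atlas: coordinate changes have positive
   Jacobian. *)
Record oriented_surface (R : realType) := OrientedSurface {
  carrier :> topologicalType;
  atlas : set (chart R carrier);
  surface_hausdorff : hausdorff_space carrier;
  surface_countable : @second_countable carrier;
  atlas_cover : forall x, exists2 c, atlas c & cdom c x;
  atlas_smooth : forall c d, atlas c -> atlas d ->
    smooth_map_on (overlap c d) (transition c d);
  atlas_oriented : forall c d, atlas c -> atlas d ->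
    forall y, overlap c d y -> 0 < jacobian (transition c d) y }.

Section Surface.
Context {R : realType} {M : oriented_surface R}.
Notation V := (R * R)%type.

Definition smooth_fun_on (U : set M) (f : M -> R) : Prop :=
  forall c, atlas c ->
    smooth_on (cimg c `&` cinv c @^-1` U) (fun y => f (cinv c y)).

Definition smooth_fun (f : M -> R) : Prop := smooth_fun_on setT f.

Definition smooth_self_map (psi : M -> M) : Prop :=
  continuous psi /\
  forall c d, atlas c -> atlas d ->
    smooth_map_on (cimg c `&` [set y | cdom d (psi (cinv c y))])
      (fun y => cmap d (psi (cinv c y))).

(* Charts of the maximal (not necessarily oriented) smooth atlas of M. *)
Definition smooth_chart (u : chart R M) : Prop :=
  forall c, atlas c ->
    smooth_map_on (overlap c u) (transition c u) /\
    smooth_map_on (overlap u c) (transition u c).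

(* [a] is the family of coefficients, in the chart c, of the operator
   sum_(i + j <= 3) a_(i,j) d_1^i d_2^j. *)
Definition coefficients (c : chart R M) (A : (M -> R) -> M -> R)
    (a : midx 3 -> V -> R) : Prop :=
  (forall s, smooth_on (cimg c) (a s)) /\
  forall f, smooth_fun f -> forall x, cdom c x ->
    A f x = \sum_(s : midx 3)
      a s (cmap c x) * pd (word_of s) (fun y => f (cinv c y)) (cmap c x).

End Surface.

Record diffeo (R : realType) (M : oriented_surface R) := Diffeo {
  dmap :> M -> M;
  dinv : M -> M;
  dmapK : cancel dmap dinv;
  dinvK : cancel dinv dmap;
  dmap_smooth : smooth_self_map dmap;
  dinv_smooth : smooth_self_map dinv }.

(* Operators are total on M -> R, but only their values on smooth
   functions are meaningful; accordingly, operators are only ever compared on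
   smooth functions. *)
Record diff3 (R : realType) (M : oriented_surface R) := Diff3 {
  op :> (M -> R) -> M -> R;
  op_coefficients : forall c, atlas c -> exists a, coefficients c op a }.

Section Operators.
Context {R : realType} {M : oriented_surface R}.
Notation V := (R * R)%type.

(* psi_* o A o psi_*^-1, where psi_* f = f o psi^-1. *)
Definition pushforward (psi : diffeo M) (A : diff3 M) : (M -> R) -> M -> R :=
  fun f x => A (fun z => f (psi z)) (dinv psi x).

Definition is_pushforward (psi : diffeo M) (A A' : diff3 M) : Prop :=
  forall f, smooth_fun f -> pushforward psi A f = A' f.

Definition equivalent (A A' : diff3 M) : Prop :=
  exists psi : diffeo M, is_pushforward psi A A'.

(* The restriction of A to open sets: for h smooth near x, the common value
   of (A F) x for all global smooth F having the same germ as h at x. For an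
   open set U, A|_U is this operator on the functions h that are smooth on U,
   evaluated at the points of U. *)
Definition restriction (A : diff3 M) : (M -> R) -> M -> R :=
  fun h x => xget 0 [set t | exists F, [/\ smooth_fun F,
    \forall z \near x, F z = h z & t = A F x]].

(* u_* o A|_U o u_*^-1 for open U in the domain of the chart u; it is an
   operator on the functions that are smooth on u(U). *)
Definition chart_pushforward (u : chart R M) (A : diff3 M) :
    (V -> R) -> V -> R :=
  fun h y => restriction A (fun z => h (cmap u z)) (cinv u y).

Definition eq_op_on (D : set V) (B B' : (V -> R) -> V -> R) : Prop :=
  forall h, smooth_on D h -> forall y, D y -> B h y = B' h y.

(* Fibre coordinates of k-jets of sections of the bundle of operators: the
   partial derivatives of order <= k of the coefficients. *)
Definition jet_coord (k : nat) (a : midx 3 -> V -> R) (y : V) :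
    'I_#|{: midx 3 * midx k}| -> R :=
  fun i => let p := enum_val i in pd (word_of p.2) (a p.1) y.

End Operators.

(* An invariant of order [inv_order] is a function of the jet [A]_x^k, written
   as a function of A and x; [None] means that it is not defined at this jet.
   By [inv_rational] the value only depends on the k-jet of A at x, and on each
   fibre of J^k over M it is a quotient P / Q, defined where Q does not
   vanish. *)
Record natural_invariant (R : realType) (M : oriented_surface R) :=
NaturalInvariant {
  inv_order : nat;
  inv_val :> diff3 M -> M -> option R;
  inv_natural : forall (psi : diffeo M) (A A' : diff3 M),
    is_pushforward psi A A' -> forall x, inv_val A' (psi x) = inv_val A x;
  inv_rational : forall c : chart R M, atlas c -> forall x, cdom c x ->
    exists P Q : mpoly.mpoly #|{: midx 3 * midx inv_order}| R,
      Q <> mpoly.mpolyC _ 0 /\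
      forall (A : diff3 M) a, coefficients c A a ->
        let j := jet_coord (k := inv_order) a (cmap c x) in
        inv_val A x = if mpoly.meval j Q == 0 then None
                      else Some (mpoly.meval j P / mpoly.meval j Q) }.

Section NaturalAtlas.
Context {R : realType} {M : oriented_surface R}.
Notation V := (R * R)%type.

(* dI_1(A) /\ dI_2(A) != 0 on the open neighbourhood U of x. *)
Definition general_position (A : diff3 M) : Prop :=
  forall x : M, exists (I1 I2 : natural_invariant M) (U : set M)
    (g : M -> V),
    [/\ open U /\ U x,
        forall z, U z -> I1 A z = Some (g z).1 /\ I2 A z = Some (g z).2,
        smooth_fun_on U (fun z => (g z).1),
        smooth_fun_on U (fun z => (g z).2) &
        forall c, atlas c -> forall z, U z -> cdom c z ->
          jacobian (fun y => g (cinv c y)) (cmap c z) != 0].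

Variables (idx : Type) (I1 I2 : idx -> natural_invariant M).

(* The preimage of D under (I_1^i(A), I_2^i(A)), a map defined on the part of M
   where both invariants of A are. *)
Definition inv_preimage (A : diff3 M) (i : idx) (D : set V) : set M :=
  [set x | exists2 y, D y & I1 i A x = Some y.1 /\ I2 i A x = Some y.2].

(* The charts u i : U_i -> D_i form a natural atlas for A with coordinates
   given by the invariants I1 i, I2 i. *)
Definition natural_atlas (A : diff3 M) (u : idx -> chart R M) : Prop :=
  [/\ forall x, exists i, cdom (u i) x,
      forall i, smooth_chart (u i),
      forall i x, cdom (u i) x ->
        I1 i A x = Some (cmap (u i) x).1 /\ I2 i A x = Some (cmap (u i) x).2,
      forall i j, i <> j ->
        ((I1 i A : M -> option R), (I2 i A : M -> option R)) <>
        ((I1 j A : M -> option R), (I2 j A : M -> option R)) &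
      (forall i, connected (cimg (u i)) /\ simply_connected (cimg (u i))) /\
      (forall i j, connected (overlap (u i) (u j)) /\
                   simply_connected (overlap (u i) (u j)))].

(* A componentwise comparison of the models (D_i, D_ij, phi_ij, A_i, A_ij) of A
   and A' for the atlases u and u'. *)
Definition same_natural_model (A A' : diff3 M) (u u' : idx -> chart R M) :
    Prop :=
  [/\ forall i, cimg (u' i) = cimg (u i),
      forall i j, overlap (u' i) (u' j) = overlap (u i) (u j),
      forall i j y, overlap (u i) (u j) y ->
        transition (u' i) (u' j) y = transition (u i) (u j) y,
      forall i, eq_op_on (cimg (u i))
        (chart_pushforward (u i) A) (chart_pushforward (u' i) A') &
      forall i j, eq_op_on (overlap (u i) (u j))
        (chart_pushforward (u i) A) (chart_pushforward (u' i) A')].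

End NaturalAtlas.

(* Main.v *)
Require Import Defs.
From mathcomp Require Import all_boot all_order all_algebra.
From mathcomp Require Import all_classical all_reals all_analysis.
Set Implicit Arguments.
Unset Strict Implicit.
Unset Printing Implicit Defensive.
Import Order.TTheory GRing.Theory Num.Theory.
Import numFieldNormedType.Exports.
Local Open Scope classical_set_scope.
Local Open Scope ring_scope.

(* A diffeomorphism psi with psi_* A = A' carries the values of all natural
   invariants of A to those of A', so the charts u_i o psi^-1 form a natural
   atlas for A' with the same model. Conversely, if the models agree, the maps
   u'_i^-1 o u_i agree on overlaps because the transition maps do, and so glue
   to a map psi; exchanging the two atlases gives its inverse. It carries A to
   A' because it does so in each pair of charts, and the value of an operator at
   a point depends only on the germ of its argument. *)

(* Recovers [dinv] and [pushforward], which mathcomp-analysis shadows. *)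
Import Defs.

(** * Differentiability of germs and the chain rule in the plane *)

Section Calculus.
Context {R : realType}.
Notation V := (R * R)%type.
Implicit Types (f h : V -> R) (g : V -> V) (x v : V) (n : nat).

(** The first-order expansion of [f] at [x] involves only the germ, so it is also an expansion of
    [h]; [diff_unique] then identifies its linear part with ['d h x]. *)
Lemma near_eq_differentiable f h x :
  (\forall z \near x, f z = h z) -> differentiable f x -> differentiable h x.
Proof.
move=> fh df; have dfc : continuous ('d f x) by case/diff_locallyP: df.
have hE : h \o shift x = cst (h x) + 'd f x +o_ (0 : V) id.
  have /diff_locallyP[_ /eqaddoP fE] := df; apply/eqaddoP => e e0.
  have := fE e e0; rewrite -(nbhs_singleton fh).
  have fh0 : \forall z \near (0 : V), f (z + x) = h (z + x).
    by move: fh; rewrite (near_shift 0 x) /= subr0.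
  by apply: filterS2 fh0 => z /= fhz; rewrite /= !fctE fhz.
by apply/diff_locallyP; rewrite (diff_unique dfc hE).
Qed.

Lemma derive_axes f x v : differentiable f x ->
  'D_v f x = v.1 * 'D_(axis false) f x + v.2 * 'D_(axis true) f x.
Proof.
move=> df; rewrite !deriveE// -![_ * 'd f x _]/(_ *: ('d f x _ : R)).
rewrite -!linearZ -linearD; congr ('d f x _).
case: v => a b; rewrite -[RHS]/(a * 1 + b * 0, a * 0 + b * 1).
by rewrite !mulr1 !mulr0 addr0 add0r.
Qed.

Definition diff_map_at x g :=
  differentiable (fun y => (g y).1) x /\ differentiable (fun y => (g y).2) x.

Lemma diff_map_atE x g : diff_map_at x g -> differentiable g x.
Proof.
move=> [d1 d2]; have := differentiable_pair d1 d2.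
by congr (differentiable _ x); apply/funext => y; rewrite -surjective_pairing.
Qed.

Lemma derive_chain f g x v :
  diff_map_at x g -> differentiable f (g x) ->
  'D_v (f \o g) x =
    'D_v (fun y => (g y).1) x * 'D_(axis false) f (g x) +
    'D_v (fun y => (g y).2) x * 'D_(axis true) f (g x).
Proof.
move=> dg df; have [d1 d2] := dg; have dg' := diff_map_atE dg.
rewrite deriveE; last exact: differentiable_comp.
rewrite diff_comp//= -deriveE// derive_axes// !deriveE//.
suff -> : 'd g x v = ('d (fun y => (g y).1) x v, 'd (fun y => (g y).2) x v) by [].
rewrite -[RHS]/((fun y => ('d (fun y => (g y).1) x y, 'd (fun y => (g y).2) x y)) v).
rewrite -diff_pair//; congr ('d _ x v).
by apply/funext => y; rewrite -surjective_pairing.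
Qed.

End Calculus.

(** * Germs of smooth functions and maps of the plane *)

Section SmoothGerms.
Context {R : realType}.
Notation V := (R * R)%type.
Implicit Types (f h : V -> R) (g : V -> V) (x v : V) (n : nat).

(* Near [x], [f] is n + 1 times differentiable. [smooth_at] lets the
   neighbourhood shrink as n grows. *)
Fixpoint ck_at n x f : Prop :=
  (\forall z \near x, differentiable f z) /\
  if n is n'.+1 then forall i, ck_at n' x ('D_(axis i) f) else True.

Definition smooth_at x f : Prop := forall n, ck_at n x f.

Definition smooth_map_at x g : Prop :=
  smooth_at x (fun y => (g y).1) /\ smooth_at x (fun y => (g y).2).

Lemma ck_at_differentiable n x f :
  ck_at n x f -> \forall z \near x, differentiable f z.
Proof. by case: n => [|n] []. Qed.

Lemma ck_atW n x f : ck_at n.+1 x f -> ck_at n x f.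
Proof.
elim: n f => [|n IH] f [df Df]; first by [].
by split=> // i; apply: IH; exact: Df.
Qed.

Lemma near_eq_pd f h x w :
  (\forall z \near x, f z = h z) -> \forall z \near x, pd w f z = pd w h z.
Proof.
move=> fh; elim: w => [//|i w IH].
(* Equality near [x] is also equality near every [z] close to [x], so the derivatives agree at such
   [z] and not only at [x]. *)
apply: filterS (near_join IH) => z /=; exact: near_eq_derive.
Qed.

Lemma near_eq_ck_at n f h x :
  (\forall z \near x, f z = h z) -> ck_at n x f -> ck_at n x h.
Proof.
elim: n f h => [|n IH] f h fh [df Df]; (split; [|try by []]).
- by apply: filterS2 (near_join fh) df => z; exact: near_eq_differentiable.
- by apply: filterS2 (near_join fh) df => z; exact: near_eq_differentiable.
by move=> i; apply: IH (Df i); exact: (near_eq_pd [:: i] fh).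
Qed.

Lemma ck_atD n f h x : ck_at n x f -> ck_at n x h -> ck_at n x (f \+ h).
Proof.
elim: n f h => [|n IH] f h [df Df] [dh Dh]; (split; [|try by []]).
- by apply: filterS2 df dh => z; exact: differentiableD.
- by apply: filterS2 df dh => z; exact: differentiableD.
move=> i; apply: near_eq_ck_at (IH _ _ (Df i) (Dh i)).
apply: filterS2 df dh => z dfz dhz.
by rewrite deriveD//; exact: diff_derivable.
Qed.

Lemma ck_atM n f h x : ck_at n x f -> ck_at n x h -> ck_at n x (f \* h).
Proof.
elim: n f h => [|n IH] f h cf ch; have [df Df] := cf; have [dh Dh] := ch;
  (split; [|try by []]).
- by apply: filterS2 df dh => z; exact: differentiableM.
- by apply: filterS2 df dh => z; exact: differentiableM.
move=> i.
(* Leibniz rule: each term has one undifferentiated factor, which is weakened to order [n]. *)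
apply: near_eq_ck_at (ck_atD (IH _ _ (ck_atW cf) (Dh i))
                             (IH _ _ (ck_atW ch) (Df i))).
apply: filterS2 df dh => z dfz dhz.
by rewrite deriveM//; exact: diff_derivable.
Qed.

(** Induction on [n]: by the chain rule a partial derivative of [f \o g] is a sum of products of
    partials of [g] with partials of [f] composed with [g], and the latter composites have lower
    order. *)
Lemma ck_at_comp n f g x :
    ck_at n x (fun y => (g y).1) -> ck_at n x (fun y => (g y).2) ->
    ck_at n (g x) f ->
  ck_at n x (f \o g).
Proof.
elim: n f => [|n IH] f c1 c2 cf;
  have [d1 D1] := c1; have [d2 D2] := c2; have [df Df] := cf.
all: have dg : \forall z \near x, diff_map_at z g by apply: filterS2 d1 d2.
all: have gx : g @ x --> g x by
  exact: differentiable_continuous (diff_map_atE (nbhs_singleton dg)).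
all: have dfg : \forall z \near x, differentiable f (g z) by exact: (gx _ df).
all: split; [by apply: filterS2 dg dfg => z /diff_map_atE;
               exact: differentiable_comp | try by []].
move=> i; apply: near_eq_ck_at.
  by apply: filterS2 dg dfg => z dgz dfz; exact: esym (derive_chain _ dgz dfz).
by apply: ck_atD; apply: ck_atM; (try by exact: D1); (try by exact: D2);
  apply: (IH ('D_(axis _) f)); (try exact: ck_atW); exact: Df.
Qed.

Lemma near_eq_smooth_at f h x :
  (\forall z \near x, f z = h z) -> smooth_at x f -> smooth_at x h.
Proof. by move=> fh sf n; exact: near_eq_ck_at (sf n). Qed.

Lemma near_eq_smooth_map_at (f g : V -> V) x :
  (\forall z \near x, f z = g z) -> smooth_map_at x f -> smooth_map_at x g.
Proof.
move=> fg [f1 f2]; split; [apply: near_eq_smooth_at f1|apply: near_eq_smooth_at f2];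
  by apply: filterS fg => z ->.
Qed.

Lemma smooth_at_comp f g x :
  smooth_map_at x g -> smooth_at (g x) f -> smooth_at x (f \o g).
Proof. by move=> [g1 g2] sf n; exact: ck_at_comp (g1 n) (g2 n) (sf n). Qed.

Lemma smooth_map_at_comp (f g : V -> V) x :
  smooth_map_at x g -> smooth_map_at (g x) f -> smooth_map_at x (f \o g).
Proof.
by move=> sg [f1 f2]; split; [exact: smooth_at_comp sg f1 | exact: smooth_at_comp sg f2].
Qed.

Lemma smooth_on_at (D : set V) f x :
  (\forall z \near x, D z) -> smooth_on D f -> smooth_at x f.
Proof.
move=> Dx sf n; elim: n f sf => [|n IH] f sf; (split; [|try by []]).
- by apply: filterS Dx => z; exact: (sf [::]).
- by apply: filterS Dx => z; exact: (sf [::]).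
move=> i; apply: IH => w z Dz.
(* [foldr] applies the last letter first, so the innermost derivative is appended at the end of the
   word. *)
by have := sf (rcons w i) z Dz; rewrite /pd foldr_rcons.
Qed.

(** For a fixed word [w] only [ck_at] at order [size w] is used, so it does not matter that the
    neighbourhoods shrink with the order. *)
Lemma smooth_at_on (D : set V) f :
  (forall x, D x -> smooth_at x f) -> smooth_on D f.
Proof.
move=> sf w x /sf /(_ (size w)) {sf}; elim/last_ind: w f => [|w i IH] f.
  by move=> /ck_at_differentiable /nbhs_singleton.
by rewrite size_rcons /pd foldr_rcons => -[_ /(_ i)]; exact: IH.
Qed.

Lemma smooth_map_on_at (D : set V) g x :
  (\forall z \near x, D z) -> smooth_map_on D g -> smooth_map_at x g.
Proof.
by move=> Dx [g1 g2]; split; [exact: smooth_on_at Dx g1 | exact: smooth_on_at Dx g2].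
Qed.

Lemma smooth_map_at_on (D : set V) g :
  (forall x, D x -> smooth_map_at x g) -> smooth_map_on D g.
Proof. by move=> sg; split; apply: smooth_at_on => x /sg []. Qed.

End SmoothGerms.

(** * Local forms of maps and functions in charts *)

Section ChartGerms.
Context {R : realType} {T : topologicalType}.
Implicit Types (u v w : chart R T) (x : T).

Lemma near_cinv u x (P : set T) :
  cdom u x -> (\forall z \near x, P z) -> \forall y \near cmap u x, P (cinv u y).
Proof.
move=> ux Px; have cu : cinv u @ cmap u x --> cinv u (cmap u x).
  exact: cinv_cont (cmap_img ux).
by apply: (cu P); rewrite cmapK.
Qed.

Lemma near_cdom u x : cdom u x -> \forall z \near x, cdom u z.
Proof. by move=> ux; exact: open_nbhs_nbhs (conj (cdom_open u) ux). Qed.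

Lemma near_cimg u x : cdom u x -> \forall y \near cmap u x, cimg u y.
Proof.
move=> ux.
by apply: open_nbhs_nbhs; split; [exact: cimg_open | exact: cmap_img].
Qed.

Lemma overlap_cmap u v x : cdom u x -> cdom v x -> overlap u v (cmap u x).
Proof. by move=> ux vx; exists x. Qed.

Lemma overlap_cinv u v y :
  overlap u v y -> [/\ cimg u y, cdom u (cinv u y) & cdom v (cinv u y)].
Proof. by move=> [x [ux vx] <-]; rewrite cmapK//; split=> //; exact: cmap_img. Qed.

Lemma near_overlap u v x : cdom u x -> cdom v x ->
  \forall y \near cmap u x, overlap u v y.
Proof.
move=> ux vx.
apply: filterS2 (near_cimg ux) (near_cinv ux (near_cdom vx)) => y uy vy.
by rewrite -(cinvK uy); apply: overlap_cmap => //; exact: cinv_dom.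
Qed.

(** With [f := id] this is smoothness of a coordinate change, so changes of chart and maps are
    composed by the same lemma. *)
Definition smooth_in u v x (f : T -> T) : Prop :=
  smooth_map_at (cmap u x) (fun y => cmap v (f (cinv u y))).

Definition smooth_fun_in u x (f : T -> R) : Prop :=
  smooth_at (cmap u x) (fun y => f (cinv u y)).

(** Continuity keeps the values of [f] near [x] inside [cdom v], where [cinv v] cancels [cmap v].
    This removes the intermediate chart from a composite. *)
Lemma near_cinv_cmap u v x (f : T -> T) :
    cdom u x -> cdom v (f x) -> f @ x --> f x ->
  \forall y \near cmap u x, cinv v (cmap v (f (cinv u y))) = f (cinv u y).
Proof.
move=> ux vfx cf; apply: (near_cinv (P := fun z => cinv v (cmap v (f z)) = f z)) ux _.
have /= cfv : \forall z \near x, cdom v (f z) := cf _ (near_cdom vfx).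
by apply: filterS cfv => z; exact: cmapK.
Qed.

Lemma smooth_in_comp u v w x (f g : T -> T) :
    cdom u x -> cdom v (g x) -> g @ x --> g x ->
    smooth_in u v x g -> smooth_in v w (g x) f ->
  smooth_in u w x (f \o g).
Proof.
move=> ux vgx cg sg sf.
have {}sf : smooth_map_at (cmap v (g (cinv u (cmap u x))))
    (fun y => cmap w (f (cinv v y))) by rewrite cmapK.
apply: near_eq_smooth_map_at (smooth_map_at_comp sg sf).
by apply: filterS (near_cinv_cmap ux vgx cg) => y /= ->.
Qed.

Lemma smooth_fun_in_comp u v x (f : T -> R) (g : T -> T) :
    cdom u x -> cdom v (g x) -> g @ x --> g x ->
    smooth_in u v x g -> smooth_fun_in v (g x) f ->
  smooth_fun_in u x (f \o g).
Proof.
move=> ux vgx cg sg sf.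
have {}sf : smooth_at (cmap v (g (cinv u (cmap u x))))
    (fun y => f (cinv v y)) by rewrite cmapK.
apply: near_eq_smooth_at (smooth_at_comp sg sf).
by apply: filterS (near_cinv_cmap ux vgx cg) => y /= ->.
Qed.

End ChartGerms.

(** * Smooth maps, smooth functions and local operators on the surface *)

Section SurfaceGerms.
Context {R : realType} {M : oriented_surface R}.
Implicit Types (c d u : chart R M) (x : M) (A : diff3 M).

Lemma smooth_chartP u : smooth_chart u <->
  forall c x, atlas c -> cdom c x -> cdom u x ->
    smooth_in c u x id /\ smooth_in u c x id.
Proof.
split=> [su c x ac cx ux|su c ac].
  have [cu uc] := su c ac; split.
  - exact: smooth_map_on_at (near_overlap cx ux) cu.
  - exact: smooth_map_on_at (near_overlap ux cx) uc.
by split; apply: smooth_map_at_on => _ [x [x1 x2] <-]; apply (su c x).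
Qed.

Lemma smooth_self_mapP (f : M -> M) : smooth_self_map f <->
  continuous f /\ forall c d x, atlas c -> atlas d ->
    cdom c x -> cdom d (f x) -> smooth_in c d x f.
Proof.
split=> -[cf sf]; split=> // c d.
  move=> x ac ad cx dx; apply: smooth_map_on_at (sf c d ac ad).
  apply: filterS2 (near_cimg cx) (near_cinv cx (cf x _ (near_cdom dx))) => y.
  by split.
move=> ac ad; apply: smooth_map_at_on => y [cy dy].
by rewrite -(cinvK cy); apply: sf => //; exact: cinv_dom.
Qed.

Lemma smooth_funP (f : M -> R) : smooth_fun f <->
  forall c x, atlas c -> cdom c x -> smooth_fun_in c x f.
Proof.
split=> [sf c x ac cx|sf c ac].
  apply: smooth_on_at (sf c ac).
  by apply: filterS (near_cimg cx) => y; split.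
apply: smooth_at_on => y [cy _].
by rewrite -(cinvK cy); apply: sf => //; exact: cinv_dom.
Qed.

Lemma smooth_fun_comp (f : M -> R) (g : M -> M) :
  smooth_self_map g -> smooth_fun f -> smooth_fun (f \o g).
Proof.
move=> /smooth_self_mapP[cg sg] /smooth_funP sf; apply/smooth_funP => c x ac cx.
have [d ad dgx] := atlas_cover (g x).
by apply: (smooth_fun_in_comp cx dgx); [exact: cg | exact: sg | exact: sf].
Qed.

Lemma smooth_fun_chart u (f : M -> R) :
  smooth_chart u -> smooth_fun f -> smooth_on (cimg u) (fun y => f (cinv u y)).
Proof.
move=> /smooth_chartP su /smooth_funP sf; apply: smooth_at_on => y uy.
have ux := cinv_dom uy; rewrite -(cinvK uy).
have [c ac cx] := atlas_cover (cinv u y).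
(* [f] is taken as [f \o id], the inner map being the coordinate change from [u] to the atlas chart
   [c]. *)
apply: (@smooth_fun_in_comp _ _ u c _ f id) => //.
- exact: (su c _ ac cx ux).2.
- exact: sf.
Qed.

(** In an atlas chart both values are the same combination of partial derivatives at one point, and
    these depend only on the germ. *)
Lemma op_local A (f g : M -> R) x : smooth_fun f -> smooth_fun g ->
  (\forall z \near x, f z = g z) -> A f x = A g x.
Proof.
move=> sf sg fg; have [c ac cx] := atlas_cover x.
have [a [_ aE]] := op_coefficients A ac; rewrite !aE//.
apply: eq_bigr => s _; congr (_ * _).
have fgu := near_cinv (P := fun z => f z = g z) cx fg.
exact: nbhs_singleton (near_eq_pd _ fgu).
Qed.

(** By locality all extensions of the germ give the same value, so [xget] selects from a
    singleton. *)
Lemma restrictionE A (f h : M -> R) x : smooth_fun f ->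
  (\forall z \near x, f z = h z) -> restriction A h x = A f x.
Proof.
move=> sf fh; apply: xget_unique; first by exists f.
move=> t [F [sF Fh ->]]; apply: op_local => //.
by apply: filterS2 fh Fh => z -> ->.
Qed.

Lemma chart_pushforwardE A u (f : M -> R) x : smooth_fun f -> cdom u x ->
  chart_pushforward u A (fun y => f (cinv u y)) (cmap u x) = A f x.
Proof.
move=> sf ux; rewrite /chart_pushforward cmapK//; apply: restrictionE => //.
by apply: filterS (near_cdom ux) => z uz; rewrite cmapK.
Qed.

End SurfaceGerms.

(** * Transport of charts, operators and natural atlases by a diffeomorphism *)

Section Transport.
Context {R : realType} {M : oriented_surface R}.
Implicit Types (c : chart R M) (x : M) (A : diff3 M).

Section ImageChart.
Variables (psi : diffeo M) (u : chart R M).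

Let psi_continuous : continuous psi. Proof. by case: (dmap_smooth psi). Qed.
Let dinv_continuous : continuous (dinv psi). Proof. by case: (dinv_smooth psi). Qed.

Fact image_chart_cdom_open : open (dinv psi @^-1` cdom u).
Proof. by apply: open_comp (cdom_open u) => x _; exact: dinv_continuous. Qed.

Fact image_chart_cmap_img x :
  (dinv psi @^-1` cdom u) x -> cimg u (cmap u (dinv psi x)).
Proof. exact: cmap_img. Qed.

Fact image_chart_cinv_dom y :
  cimg u y -> (dinv psi @^-1` cdom u) (psi (cinv u y)).
Proof. by move=> uy; rewrite /preimage /= dmapK; exact: cinv_dom. Qed.

Fact image_chart_cmapK x :
  (dinv psi @^-1` cdom u) x -> psi (cinv u (cmap u (dinv psi x))) = x.
Proof. by move=> ux; rewrite cmapK// dinvK. Qed.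

Fact image_chart_cinvK y : cimg u y -> cmap u (dinv psi (psi (cinv u y))) = y.
Proof. by move=> uy; rewrite dmapK cinvK. Qed.

Fact image_chart_cmap_cont x : (dinv psi @^-1` cdom u) x ->
  {for x, continuous (cmap u \o dinv psi)}.
Proof.
by move=> ux; apply: continuous_comp; [exact: dinv_continuous | exact: cmap_cont].
Qed.

Fact image_chart_cinv_cont y : cimg u y -> {for y, continuous (psi \o cinv u)}.
Proof.
by move=> uy; apply: continuous_comp; [exact: cinv_cont | exact: psi_continuous].
Qed.

Definition image_chart : chart R M :=
  Chart image_chart_cdom_open (@cimg_open _ _ u) image_chart_cmap_img
    image_chart_cinv_dom image_chart_cmapK image_chart_cinvK
    image_chart_cmap_cont image_chart_cinv_cont.

Lemma image_chart_smooth : smooth_chart u -> smooth_chart image_chart.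
Proof.
move=> /smooth_chartP su; apply/smooth_chartP => c x ac cx ux.
have [_ sinv] := (smooth_self_mapP _).1 (dinv_smooth psi).
have [_ spsi] := (smooth_self_mapP _).1 (dmap_smooth psi).
(* The two coordinate changes are the local forms of [dinv psi] from [c] to [u] and of [psi] from
   [u] to [c]; both are factored through an atlas chart [d] around [dinv psi x]. *)
have [d ad dx] := atlas_cover (dinv psi x).
have [du ud] := su d (dinv psi x) ad dx ux; split.
  exact: smooth_in_comp cx dx (@dinv_continuous x) (sinv c d x ac ad cx dx) du.
apply: (@smooth_in_comp _ _ u d c (dinv psi x) psi id) => //.
by apply: spsi => //; rewrite dinvK.
Qed.

End ImageChart.

Lemma overlap_image_chart (psi : diffeo M) (u v : chart R M) :
  overlap (image_chart psi u) (image_chart psi v) = overlap u v.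
Proof.
apply/seteqP; split=> _ [x [ux vx] <-]; first by exists (dinv psi x).
by exists (psi x); rewrite /= /preimage /= ?dmapK.
Qed.

Lemma transition_image_chart (psi : diffeo M) (u v : chart R M) :
  transition (image_chart psi u) (image_chart psi v) =1 transition u v.
Proof. by move=> y; rewrite /transition /= dmapK. Qed.

Lemma is_pushforwardE (psi : diffeo M) A A' (f : M -> R) x :
    is_pushforward psi A A' -> smooth_fun f ->
  A' f (psi x) = A (f \o psi) x.
Proof. by move=> AA' sf; rewrite -(AA' f sf) /pushforward /= dmapK. Qed.

(** Composition with [psi] matches the global extensions of the two germs, so the sets of candidate
    values are equal. Hence [xget] agrees for arbitrary [h], even where it returns its default. *)
Lemma restriction_pushforward (psi : diffeo M) A A' (h : M -> R) x :
    is_pushforward psi A A' ->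
  restriction A' h (psi x) = restriction A (h \o psi) x.
Proof.
move=> AA'; rewrite /restriction; congr (xget 0 _).
have [cpsi _] := dmap_smooth psi; have [cdinv _] := dinv_smooth psi.
apply/seteqP; split=> t [F [sF Fh ->]].
  exists (F \o psi); rewrite -(is_pushforwardE _ AA')//; split=> //.
    exact: smooth_fun_comp (dmap_smooth psi) sF.
  exact: (cpsi x _ Fh).
have sF' : smooth_fun (F \o dinv psi) by exact: smooth_fun_comp (dinv_smooth psi) sF.
exists (F \o dinv psi); split=> //.
  have {}Fh : \forall z \near dinv psi (psi x), F z = (h \o psi) z by rewrite dmapK.
  have Fh' : \forall z \near psi x, F (dinv psi z) = h (psi (dinv psi z)).
    exact: (cdinv _ _ Fh).
  by apply: filterS Fh' => z; rewrite dinvK.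
rewrite (is_pushforwardE _ AA')//; congr (op A _ x).
by apply/funext => z; rewrite /= dmapK.
Qed.

Lemma chart_pushforward_image (psi : diffeo M) A A' (u : chart R M) :
    is_pushforward psi A A' ->
  chart_pushforward (image_chart psi u) A' = chart_pushforward u A.
Proof.
move=> AA'; apply/funext => h; apply/funext => y.
rewrite /chart_pushforward /= (restriction_pushforward _ _ AA').
by congr restriction; apply/funext => z; rewrite /= dmapK.
Qed.

Section NaturalAtlas.
Variables (idx : Type) (I1 I2 : idx -> natural_invariant M).
Variables (psi : diffeo M) (A A' : diff3 M).
Hypothesis AA' : is_pushforward psi A A'.

Lemma inv_pushforward (I : natural_invariant M) x : I A' x = I A (dinv psi x).
Proof. by rewrite -(inv_natural I AA') dinvK. Qed.

Lemma inv_preimage_pushforward i D :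
  inv_preimage I1 I2 A' i D = dinv psi @^-1` inv_preimage I1 I2 A i D.
Proof.
by apply/seteqP; split=> x [y Dy Iy]; exists y => //;
  move: Iy; rewrite !inv_pushforward.
Qed.

Lemma natural_atlas_pushforward (u : idx -> chart R M) :
  natural_atlas I1 I2 A u ->
  natural_atlas I1 I2 A' (fun i => image_chart psi (u i)).
Proof.
move=> [cover su uI uneq [sc scij]]; split.
- by move=> x; have [i ui] := cover (dinv psi x); exists i.
- by move=> i; exact: image_chart_smooth.
- by move=> i x ux; rewrite !inv_pushforward; exact: uI.
(* A coincidence of two pairs for [A'] is pulled back along [psi] to one for [A]. *)
- move=> i j ij [e1 e2]; apply: (uneq i j ij); congr pair; apply/funext => x.
  + by rewrite -!(inv_natural _ AA') e1.
  + by rewrite -!(inv_natural _ AA') e2.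
- by split=> // i j; rewrite overlap_image_chart.
Qed.

Lemma same_natural_model_pushforward (u : idx -> chart R M) :
  same_natural_model A A' u (fun i => image_chart psi (u i)).
Proof.
split=> //.
- by move=> i j; exact: overlap_image_chart.
- by move=> i j y _; exact: transition_image_chart.
- by move=> i h _ y _; rewrite (chart_pushforward_image _ AA').
- by move=> i j h _ y _; rewrite (chart_pushforward_image _ AA').
Qed.

End NaturalAtlas.

End Transport.

(** * Gluing a diffeomorphism from two atlases with the same transition maps *)

Section Glue.
Context {R : realType} {M : oriented_surface R} {idx : Type}.
Implicit Types (u : idx -> chart R M) (x : M).

Definition covering u := forall x, exists i, cdom (u i) x.

(** The part of [same_natural_model] that concerns the charts alone; its symmetry yields the inverse
    of the glued map. *)
Definition same_transitions u u' : Prop :=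
  [/\ forall i, cimg (u' i) = cimg (u i),
      forall i j, overlap (u' i) (u' j) = overlap (u i) (u j) &
      forall i j y, overlap (u i) (u j) y ->
        transition (u' i) (u' j) y = transition (u i) (u j) y].

Lemma same_transitions_sym u u' : same_transitions u u' -> same_transitions u' u.
Proof.
move=> [img ov tr]; split=> [i|i j|i j y]; first by rewrite img.
- by rewrite ov.
- by rewrite ov => uy; rewrite tr.
Qed.

(** The chart around [x] is picked by choice; [glueE] shows that any other gives the same value. *)
Definition glue u u' (cu : covering u) x : M :=
  let i := sval (cid (cu x)) in cinv (u' i) (cmap (u i) x).

(** Let [j] be the chosen index. Equal overlaps put [cinv (u' j) (cmap (u j) x)] in the domain of
    [u' i], and equal transitions give it the coordinates [cmap (u i) x] there. *)
Lemma glueE u u' (cu : covering u) i x : same_transitions u u' ->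
  cdom (u i) x -> glue u' cu x = cinv (u' i) (cmap (u i) x).
Proof.
rewrite /glue => -[img ov tr] ui; case: cid => j /= uj.
have uji := overlap_cmap uj ui.
have [_ _ u'i] : [/\ cimg (u' j) (cmap (u j) x),
  cdom (u' j) (cinv (u' j) (cmap (u j) x)) &
  cdom (u' i) (cinv (u' j) (cmap (u j) x))] by apply: overlap_cinv; rewrite ov.
have := tr j i _ uji; rewrite /transition cmapK// => <-.
by rewrite cmapK.
Qed.

Lemma glue_cdom u u' (cu : covering u) i x : same_transitions u u' ->
  cdom (u i) x -> cdom (u' i) (glue u' cu x).
Proof.
move=> uu' ui; rewrite (glueE _ uu' ui); apply: cinv_dom.
by have [-> _ _] := uu'; exact: cmap_img.
Qed.

Lemma glueK u u' (cu : covering u) (cu' : covering u') :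
  same_transitions u u' -> cancel (glue u' cu) (glue u cu').
Proof.
move=> uu' x; have [i ui] := cu x.
have u'i := glue_cdom cu uu' ui.
rewrite (glueE _ (same_transitions_sym uu') u'i) (glueE _ uu' ui).
by rewrite cinvK ?cmapK//; have [-> _ _] := uu'; exact: cmap_img.
Qed.

Lemma near_glue u u' (cu : covering u) i x : same_transitions u u' ->
  cdom (u i) x -> \forall z \near x, cinv (u' i) (cmap (u i) z) = glue u' cu z.
Proof.
by move=> uu' ui; apply: filterS (near_cdom ui) => z uz; rewrite (glueE _ uu' uz).
Qed.

Lemma glue_continuous u u' (cu : covering u) :
  same_transitions u u' -> continuous (glue u' cu).
Proof.
move=> uu' x; have [i ui] := cu x; have [img _ _] := uu'.
suff : cinv (u' i) \o cmap (u i) @ x --> glue u' cu x.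
  by apply: cvg_trans; apply: near_eq_cvg; exact: near_glue.
rewrite (glueE _ uu' ui); apply: continuous_comp; first exact: cmap_cont.
by apply: cinv_cont; rewrite img; exact: cmap_img.
Qed.

Lemma glue_smooth u u' (cu : covering u) : same_transitions u u' ->
    (forall i, smooth_chart (u i)) -> (forall i, smooth_chart (u' i)) ->
  smooth_self_map (glue u' cu).
Proof.
move=> uu' su su'; have cg : continuous (glue u' cu) by exact: glue_continuous.
apply/smooth_self_mapP; split=> // c d x ac ad cx dx.
have [i ui] := cu x; have u'i := glue_cdom cu uu' ui.
have [img _ _] := uu'.
have [sc _] := (smooth_chartP _).1 (su i) c x ac cx ui.
have [_ sd] := (smooth_chartP _).1 (su' i) d _ ad dx u'i.
apply: (@smooth_in_comp _ _ c (u i) d x (glue u' cu) id) => //.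
(* Read in [u i], the glued map is the coordinate change from [u' i] to [d]. *)
move: sd; rewrite /smooth_in {1}(glueE _ uu' ui) cinvK; last first.
  by rewrite img; exact: cmap_img.
apply: near_eq_smooth_map_at.
apply: filterS (near_cimg ui) => y uy.
by rewrite (glueE _ uu' (cinv_dom uy)) cinvK.
Qed.

Lemma same_natural_model_equivalent (A A' : diff3 M) u u' :
    covering u -> covering u' ->
    (forall i, smooth_chart (u i)) -> (forall i, smooth_chart (u' i)) ->
    same_natural_model A A' u u' ->
  equivalent A A'.
Proof.
move=> cu cu' su su' [img ov tr AA' _].
have uu' : same_transitions u u' by split.
have u'u := same_transitions_sym uu'.
exists (Diffeo (glueK cu cu' uu') (glueK cu' cu u'u)
  (glue_smooth cu uu' su su') (glue_smooth cu' u'u su' su)).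
move=> f sf; apply/funext => x; rewrite /pushforward /=.
have [i u'i] := cu' x; have ui := glue_cdom cu' u'u u'i.
have sfg : smooth_fun (f \o glue u' cu).
  exact: smooth_fun_comp (glue_smooth cu uu' su su') sf.
have imgx : cimg (u i) (cmap (u' i) x) by rewrite -img; exact: cmap_img.
(* [A' f x] is computed in [u' i] and moved to [u i] by equality of the local operators, tested on
   the local form of [f] in [u' i]. *)
rewrite -(chart_pushforwardE A' sf u'i) -AA'//; last first.
  by rewrite -img; exact: smooth_fun_chart.
(* The function now restricted is [f] after [cinv (u' i)] and [cmap (u i)]; it has the germ of the
   globally smooth [f \o glue u' cu]. *)
rewrite /chart_pushforward -(glueE cu' u'u u'i); apply/esym/restrictionE => //.
by apply: filterS (near_cdom ui) => z uz; rewrite /= (glueE _ uu' uz).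
Qed.

End Glue.

(** A chart of a natural atlas may be smaller than the full preimage of its image, on which the
    invariants need not be injective. Hence two forms: equality of domains when every [u i] fills
    its preimage, inclusion in general. *)
Theorem theorem22 (R : realType) (M : oriented_surface R) (A A' : diff3 M)
    (hA : general_position A) (hA' : general_position A')
    (idx : Type) (I1 I2 : idx -> natural_invariant M) (u : idx -> chart R M)
    (hu : natural_atlas I1 I2 A u) :
  ((forall i, cdom (u i) = inv_preimage I1 I2 A i (cimg (u i))) ->
   (equivalent A A' <->
    exists u' : idx -> chart R M,
      [/\ forall i, cdom (u' i) = inv_preimage I1 I2 A' i (cimg (u i)),
          natural_atlas I1 I2 A' u' &
          same_natural_model A A' u u']))
  /\
  (equivalent A A' <->
   exists u' : idx -> chart R M,
     [/\ forall i, cdom (u' i) `<=` inv_preimage I1 I2 A' i (cimg (u i)),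
         natural_atlas I1 I2 A' u' &
         same_natural_model A A' u u']).
Proof.
have [cu su uI _ _] := hu.
have backward u' : natural_atlas I1 I2 A' u' -> same_natural_model A A' u u' ->
    equivalent A A'.
  by move=> [cu' su' _ _ _]; exact: same_natural_model_equivalent.
have forward (psi : diffeo M) (AA' : is_pushforward psi A A') :
    natural_atlas I1 I2 A' (fun i => image_chart psi (u i)) /\
    same_natural_model A A' u (fun i => image_chart psi (u i)).
  split; first exact (natural_atlas_pushforward AA' hu).
  exact: same_natural_model_pushforward AA' u.
split=> [domE|]; (split=> [[psi AA']|[u' [_ hu' uu']]]; last exact: backward hu' uu').
all: have [atl mod] := forward _ AA'.
all: exists (fun i => image_chart psi (u i)); split=> // i.
(* Preimages for [A'] are the images under [psi] of those for [A], which settles the case of full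
   preimages; for the inclusion, the coordinates of [dinv psi x] in [u i] are the witness. *)
all: rewrite (inv_preimage_pushforward I1 I2 AA') -?domE// => x ux.
by exists (cmap (u i) (dinv psi x)); [exact: cmap_img | exact: uI].
Qed.
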